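(* Let $(M,\varphi)$ be an almost Golden manifold and let $\nabla$ be a derivation law on $M$. Let $\nabla^{0}$ be the derivation law given by $$\nabla^{0}_XY=\nabla_XY-\frac12(\nabla_XJ_\varphi)J_\varphi Y,\quad\forall X,Y\in\mathfrak{X}(M).$$ The set of derivation laws adapted to $\varphi$ is $\{\nabla^{0}+Q\colon Q\in\mathcal{L}\}$, where $$\mathcal{L}=\{Q\in\mathcal{T}^1_2(M)\colon Q(X,J_\varphi Y)=J_\varphi Q(X,Y),\ \forall X,Y\in\mathfrak{X}(M)\}.$$
   Context: Manifolds and tensor fields are of class $C^\infty$; $\mathfrak{X}(M)$ denotes the module of vector fields on $M$. A derivation law on $M$ is the covariant derivative of a linear connection on $M$. An almost Golden manifold $(M,\varphi)$ is a manifold $M$ with an almost Golden structure, i.e. a tensor field $\varphi$ of type $(1,1)$ with $\varphi^2=\varphi+Id$ (a polynomial structure of degree exactly 2, i.e. $\varphi$ and $Id$ are linearly independent). The induced almost product structure is $J_\varphi=\frac{1}{\sqrt5}(2\varphi-Id)$, which satisfies $J_\varphi^2=Id$. A derivation law $\nabla$ is adapted to $\varphi$ if $\nabla\varphi=0$. $\mathcal{T}^1_2(M)$ is the module of tensor fields $Q$ on $M$ that are $C^\infty(M)$-bilinear maps $\mathfrak{X}(M)\times\mathfrak{X}(M)\to\mathfrak{X}(M)$. $\nabla^0+Q$ denotes the derivation law $(X,Y)\mapsto\nabla^0_XY+Q(X,Y)$. *)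

(* Defs.v *)
From HB Require Import structures.
From mathcomp Require Import all_boot all_order all_algebra.
From mathcomp Require Import all_classical all_reals all_analysis.

Set Implicit Arguments.
Unset Strict Implicit.
Unset Printing Implicit Defensive.

Import Order.TTheory GRing.Theory Num.Theory.
Import numFieldNormedType.Exports.

Local Open Scope classical_set_scope.
Local Open Scope ring_scope.

Section SmoothEuclidean.
Context {R : realType} {n : nat}.

(* Meant for open [U]: all partial derivatives of [f] of order at most [k]
   exist and are continuous on [U]. *)
Fixpoint class_C {W : normedModType R} (k : nat) (U : set 'rV[R]_n)
    (f : 'rV[R]_n -> W) : Prop :=
  (forall x, U x -> {for x, continuous f}) /\
  if k is k'.+1 then
    forall i : 'I_n, (forall x, U x -> derivable f x (delta_mx 0 i)) /\
                     class_C k' U ('D_(delta_mx 0 i) f)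
  else True.

Definition smooth_on {W : normedModType R} (U : set 'rV[R]_n)
  (f : 'rV[R]_n -> W) : Prop := forall k, class_C k U f.

Lemma class_C_ext (W : normedModType R) k (U : set 'rV[R]_n)
    (f g : 'rV[R]_n -> W) :
  open U -> {in U, f =1 g} -> class_C k U f -> class_C k U g.
Proof.
move=> oU.
have near_fg (f' g' : 'rV[R]_n -> W) (x : 'rV[R]_n) :
    {in U, f' =1 g'} -> U x -> {near x, f' =1 g'}.
  move=> fg Ux; near=> y; apply: fg; rewrite inE; near: y.
  exact: open_nbhs_nbhs.
have cont_fg (f' g' : 'rV[R]_n -> W) : {in U, f' =1 g'} ->
    (forall x, U x -> {for x, continuous f'}) ->
    forall x, U x -> {for x, continuous g'}.
  move=> fg cf x Ux; suff : g' @ x --> f' x by rewrite fg ?inE.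
  exact: cvg_trans (near_eq_cvg (near_fg _ _ _ fg Ux)) (cf x Ux).
elim: k f g => [|k IHk] f g fg [cf df]; split=> //; try exact: cont_fg cf.
move=> i; have [dfi Cfi] := df i; split.
  by move=> x Ux; apply: near_eq_derivable (dfi x Ux); exact: near_fg.
apply: IHk Cfi => x; rewrite inE => Ux.
by apply: near_eq_derive; exact: near_fg.
Unshelve. all: by end_near. Qed.

Lemma class_CW (W : normedModType R) k (U : set 'rV[R]_n)
    (f : 'rV[R]_n -> W) :
  class_C k.+1 U f -> class_C k U f.
Proof.
elim: k f => [|k IHk] f [cf df]; first by split.
by split=> // i; have [dfi Cfi] := df i; split=> //; exact: IHk.
Qed.

Lemma class_C_cst (W : normedModType R) k (U : set 'rV[R]_n) (a : W) :
  open U -> class_C k U (cst a).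
Proof.
move=> oU; elim: k a => [|k IHk] a; split=> //;
  try by move=> x _; exact: cst_continuous.
move=> i; split=> [x _|]; first exact: derivable_cst.
by apply: (class_C_ext oU _ (IHk 0)) => x _; rewrite derive_cst.
Qed.

Lemma class_CD (W : normedModType R) k (U : set 'rV[R]_n)
    (f g : 'rV[R]_n -> W) :
  open U -> class_C k U f -> class_C k U g -> class_C k U (f + g).
Proof.
move=> oU; elim: k f g => [|k IHk] f g [cf df] [cg dg]; split=> //;
  try by move=> x Ux; apply: continuousD; [exact: cf|exact: cg].
move=> i; have [dfi Cfi] := df i; have [dgi Cgi] := dg i; split.
  by move=> x Ux; apply: derivableD; [exact: dfi|exact: dgi].
apply: (class_C_ext oU _ (IHk _ _ Cfi Cgi)) => x; rewrite inE => Ux.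
by rewrite deriveD//; [exact: dfi|exact: dgi].
Qed.

Lemma class_CM k (U : set 'rV[R]_n) (f g : 'rV[R]_n -> R) :
  open U -> class_C k U f -> class_C k U g -> class_C k U (f * g).
Proof.
move=> oU; elim: k f g => [|k IHk] f g Cf Cg; have [cf df] := Cf;
  have [cg dg] := Cg; split=> //;
  try by move=> x Ux; apply: continuousM; [exact: cf|exact: cg].
move=> i; have [dfi Cfi] := df i; have [dgi Cgi] := dg i; split.
  by move=> x Ux; apply: derivableM; [exact: dfi|exact: dgi].
apply: (class_C_ext oU _ (class_CD oU (IHk _ _ (class_CW Cf) Cgi)
  (IHk _ _ (class_CW Cg) Cfi))) => x; rewrite inE => Ux.
by rewrite deriveM//; [exact: dfi|exact: dgi].
Qed.

End SmoothEuclidean.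

Record chart (R : realType) (n : nat) (M : topologicalType) := Chart {
  chart_dom : set M ;
  chart_cod : set 'rV[R]_n ;
  chart_map : M -> 'rV[R]_n ;
  chart_inv : 'rV[R]_n -> M ;
  chart_dom_open : open chart_dom ;
  chart_cod_open : open chart_cod ;
  chart_map_cod : forall p, chart_dom p -> chart_cod (chart_map p) ;
  chart_inv_dom : forall x, chart_cod x -> chart_dom (chart_inv x) ;
  chart_mapK : forall p, chart_dom p -> chart_inv (chart_map p) = p ;
  chart_invK : forall x, chart_cod x -> chart_map (chart_inv x) = x ;
  chart_map_continuous : forall p, chart_dom p -> {for p, continuous chart_map} ;
  chart_inv_continuous : forall x, chart_cod x -> {for x, continuous chart_inv}
}.

(* The atlas need not be maximal: it determines the smooth structure. *)
Record manifold (R : realType) (n : nat) := Manifold {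
  manifold_carrier :> topologicalType ;
  manifold_hausdorff : hausdorff_space manifold_carrier ;
  manifold_second_countable : @second_countable manifold_carrier ;
  atlas : set (chart R n manifold_carrier) ;
  atlas_cover : forall p : manifold_carrier,
    exists2 c, atlas c & chart_dom c p ;
  atlas_compatible : forall c d, atlas c -> atlas d ->
    smooth_on (chart_cod c `&` chart_inv c @^-1` chart_dom d)
              (chart_map d \o chart_inv c)
}.

Section SmoothFunctions.
Context {R : realType} {n : nat} (M : manifold R n).

Definition smooth_pred : {pred M -> R} := fun f =>
  `[< forall c, atlas (m := M) c ->
        smooth_on (chart_cod c) (f \o chart_inv c) >].

(* C^oo(M) *)
Record smooth_fun := SmoothFun {
  smooth_fun_val :> M -> R ;
  smooth_funP : smooth_fun_val \in smooth_pred
}.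

HB.instance Definition _ := [isSub for smooth_fun_val].
HB.instance Definition _ := [Choice of smooth_fun by <:].

Lemma smooth_pred_cst (a : R) : (cst a : M -> R) \in smooth_pred.
Proof.
by apply/asboolP => c _ k; apply: class_C_cst; exact: chart_cod_open.
Qed.

Lemma smooth_predD : {in smooth_pred &, forall f g, f + g \in smooth_pred}.
Proof.
move=> f g /asboolP sf /asboolP sg; apply/asboolP => c Mc k.
apply: (@class_CD _ _ _ _ _ (f \o chart_inv c) (g \o chart_inv c)).
- exact: chart_cod_open.
- exact: sf.
- exact: sg.
Qed.

Lemma smooth_predM : {in smooth_pred &, forall f g, f * g \in smooth_pred}.
Proof.
move=> f g /asboolP sf /asboolP sg; apply/asboolP => c Mc k.
apply: (@class_CM _ _ _ _ (f \o chart_inv c) (g \o chart_inv c)).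
- exact: chart_cod_open.
- exact: sf.
- exact: sg.
Qed.

Lemma smooth_predZ (a : R) : {in smooth_pred, forall f, a *: f \in smooth_pred}.
Proof. by move=> f sf; apply: smooth_predM sf; exact: smooth_pred_cst. Qed.

Lemma smooth_pred_subring : GRing.subring_closed smooth_pred.
Proof.
split; [exact: smooth_pred_cst| |exact: smooth_predM].
move=> f g sf sg; apply: smooth_predD => //.
by rewrite -scaleN1r; exact: smooth_predZ.
Qed.

Lemma smooth_pred_submod : GRing.submod_closed smooth_pred.
Proof.
split; first exact: smooth_pred_cst.
by move=> a f g sf sg; apply: smooth_predD => //; exact: smooth_predZ.
Qed.

HB.instance Definition _ := GRing.SubChoice_isSubComPzRing.Build
  (M -> R) smooth_pred smooth_fun smooth_pred_subring.
HB.instance Definition _ := GRing.SubZmodule_isSubLmodule.Build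
  R (M -> R) smooth_pred smooth_fun smooth_pred_submod.

End SmoothFunctions.

Section VectorFields.
Context {R : realType} {n : nat} (M : manifold R n).
Local Notation C := (smooth_fun M).

(* The codomain is the regular module [C^o], so that the ambient space of maps
   is a [C]-module for the pointwise product [(f *: X) g = f * X g]. *)
Definition derivation_pred : {pred C -> C^o} := fun X =>
  `[< [/\ forall f g : C, X (f + g) = X f + X g,
          forall (a : R) (f : C), X (a *: f) = a *: (X f : C) &
          forall f g : C, X (f * g) = (X f : C) * g + f * (X g : C)] >].

(* Vector fields are the R-derivations of the algebra C^oo(M). *)
Record vector_field := VectorField {
  vector_field_val :> C -> C^o ;
  vector_fieldP : vector_field_val \in derivation_pred
}.

HB.instance Definition _ := [isSub for vector_field_val].
HB.instance Definition _ := [Choice of vector_field by <:].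

Lemma smooth_scalerAl (a : R) (f g : C) : a *: (f * g) = a *: f * g.
Proof. by apply/val_inj/funext => p; rewrite /= -[LHS]/(a * (f p * g p)) mulrA. Qed.

Lemma derivation_pred_submod : GRing.submod_closed derivation_pred.
Proof.
split.
  apply/asboolP; split=> [f g|a f|f g].
  - by rewrite addr0.
  - by rewrite -[RHS]/(a *: 0) scaler0.
  - by rewrite -[RHS]/(0 * g + f * 0) mul0r mulr0 addr0.
move=> h X Y /asboolP[XD XZ XM] /asboolP[YD YZ YM]; apply/asboolP.
split=> [f g|a f|f g].
- rewrite -[LHS]/(h * X (f + g) + Y (f + g)) XD YD mulrDr.
  by rewrite -[RHS]/((h * X f + Y f) + (h * X g + Y g)) addrACA.
- rewrite -[LHS]/(h * X (a *: f) + Y (a *: f)) XZ YZ.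
  rewrite -[RHS]/(a *: ((h * X f + Y f) : C)) scalerDr.
  by rewrite mulrC -smooth_scalerAl mulrC.
- rewrite -[LHS]/(h * X (f * g) + Y (f * g)) XM YM.
  rewrite -[RHS]/((h * X f + Y f) * g + f * (h * X g + Y g)).
  by rewrite !mulrDr mulrDl addrACA mulrA [h * (f * _)]mulrCA.
Qed.

HB.instance Definition _ := GRing.SubChoice_isSubLmodule.Build
  C (C -> C^o) derivation_pred vector_field derivation_pred_submod.

End VectorFields.

Section AlmostGolden.
Context {R : realType} {n : nat} (M : manifold R n).
Local Notation C := (smooth_fun M).
Local Notation XM := (vector_field M).

(* Tensor fields of type (1,1) are the C^oo(M)-linear maps
   [{linear XM -> XM}]; the tangent vector of [X] at [p] is [f |-> X f p]. *)
Definition almost_golden (phi : {linear XM -> XM}) : Prop :=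
  (forall X, phi (phi X) = phi X + X) /\
  (* phi and Id are linearly independent at each point *)
  (forall (p : M) (a b : R),
     (forall (X : XM) (f : C), a * (phi X f : C) p + b * (X f : C) p = 0) ->
     a = 0 /\ b = 0).

(* Multiplication by a real number, as the corresponding constant function. *)
Definition scale_real (a : R) (X : XM) : XM := (a *: (1 : C)) *: X.

Definition J_ (phi : {linear XM -> XM}) (X : XM) : XM :=
  scale_real (Num.sqrt 5)^-1 (phi X *+ 2 - X).

Definition derivation_law (D : XM -> XM -> XM) : Prop :=
  [/\ forall Y, linear (D ^~ Y),
      forall X Y Z, D X (Y + Z) = D X Y + D X Z &
      forall X (f : C) Y, D X (f *: Y) = (X f : C) *: Y + f *: D X Y].

(* (D_X F) Y *)
Definition covariant_derivative (D : XM -> XM -> XM) (F : XM -> XM) (X Y : XM)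
  : XM := D X (F Y) - F (D X Y).

Definition adapted (phi : {linear XM -> XM}) (D : XM -> XM -> XM) : Prop :=
  forall X Y, covariant_derivative D phi X Y = 0.

Definition nabla0 (phi : {linear XM -> XM}) (nabla : XM -> XM -> XM) (X Y : XM)
  : XM :=
  nabla X Y -
  scale_real 2^-1 (covariant_derivative nabla (J_ phi) X (J_ phi Y)).

Definition tensor12 : set (XM -> XM -> XM) := [set Q |
  (forall Y, linear (Q ^~ Y)) /\ (forall X, linear (Q X))].

Definition tensorL (phi : {linear XM -> XM}) : set (XM -> XM -> XM) := [set Q |
  tensor12 Q /\ forall X Y, Q X (J_ phi Y) = J_ phi (Q X Y)].

End AlmostGolden.

(* Main.v *)
Require Import Defs.
From mathcomp Require Import all_boot all_order all_algebra.
From mathcomp Require Import all_classical all_reals all_analysis.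
Local Open Scope classical_set_scope.
Local Open Scope ring_scope.

(** Write [J] for [J_ phi].  As [J] is an affine function of [phi] with
    constant real coefficients and [Id] is parallel, [D_X J] is the nonzero
    constant [2 / sqrt 5] times [D_X phi] ([covariant_derivative_J]); hence a
    derivation law is adapted to [phi] exactly when it commutes with [J] in its
    second argument ([adapted_J]).

    Since [J] is an involution ([JK]), expanding the definition gives
    [nabla0 X Y = 1/2 (nabla X Y + J (nabla X (J Y)))] ([nabla0E]): it is the
    average of [nabla] and its conjugate by [J].  An average of two derivation
    laws is a derivation law ([nabla0_derivation_law]), and an average over the
    conjugation by an involution commutes with that involution ([nabla0_J]).

    The derivation laws form an affine space directed by the tensor fields of
    type (1,2) ([derivation_lawD], [derivation_lawB]), and commutation with [J]
    is a linear condition.  With [nabla0] as origin, it therefore becomes the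
    same condition on the difference tensor, which is the definition of
    [tensorL]. *)

Set Implicit Arguments.
Unset Strict Implicit.
Unset Printing Implicit Defensive.

Import GRing.Theory Num.Theory.

Section Connections.
Context {R : realType} {n : nat} {M : manifold R n}.
Local Notation C := (smooth_fun M).
Local Notation XM := (vector_field M).
Implicit Types (X Y Z : XM) (a b : R) (D Q : XM -> XM -> XM).

Lemma scale_real_comp a b X : scale_real a (scale_real b X) = scale_real (a * b) X.
Proof. by rewrite /scale_real scalerA -smooth_scalerAl mul1r scalerA. Qed.

Lemma scale_real1 X : scale_real 1 X = X.
Proof. by rewrite /scale_real !scale1r. Qed.

Lemma scale_realDl a b X :
  scale_real (a + b) X = scale_real a X + scale_real b X.
Proof. by rewrite /scale_real !scalerDl. Qed.

Lemma scale_realDr a X Y :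
  scale_real a (X + Y) = scale_real a X + scale_real a Y.
Proof. by rewrite /scale_real scalerDr. Qed.

Lemma scale_realBr a X Y :
  scale_real a (X - Y) = scale_real a X - scale_real a Y.
Proof. by rewrite /scale_real scalerBr. Qed.

Lemma scale_realZ a (f : C) X : scale_real a (f *: X) = f *: scale_real a X.
Proof. by rewrite /scale_real !scalerA mulrC. Qed.

Lemma scale_real2 X : scale_real 2 X = X + X.
Proof. by rewrite scale_realDl scale_real1. Qed.

Lemma scale_real_half X : scale_real 2^-1 (X + X) = X.
Proof. by rewrite -scale_real2 scale_real_comp mulVf ?scale_real1 ?pnatr_eq0. Qed.

Lemma scale_real_eq0 a X : a != 0 -> scale_real a X = 0 -> X = 0.
Proof.
move=> a0 aX0.
by rewrite -[X]scale_real1 -(mulVf a0) -scale_real_comp aX0 /scale_real scaler0.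
Qed.

(** By the Leibniz rule, since [1 = 1 * 1]. *)
Lemma vector_field_cst X a : X (a *: (1 : C)) = 0.
Proof.
have /asboolP[_ XZ XMul] := vector_fieldP X.
have X1 : (X 1 : C) = 0.
  have := XMul 1 1; rewrite !mulr1 mul1r => /eqP.
  by rewrite -subr_eq0 opprD addNKr oppr_eq0 => /eqP.
by rewrite XZ X1 scaler0.
Qed.

Lemma derivation_law_scale_real D X Y a : derivation_law D ->
  D X (scale_real a Y) = scale_real a (D X Y).
Proof. by case=> _ _ DM; rewrite /scale_real DM vector_field_cst scale0r add0r. Qed.

Lemma derivation_law_sub D X Y Z : derivation_law D ->
  D X (Y - Z) = D X Y - D X Z.
Proof.
by case=> _ DD _; apply/eqP; rewrite eq_sym subr_eq -DD subrK.
Qed.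

Lemma derivation_lawD D Q : derivation_law D -> tensor12 Q ->
  derivation_law (fun X Y => D X Y + Q X Y).
Proof.
move=> [D1 DD DM] [Q1 Q2]; split=> [Y f X Z|X Y Z|X f Y].
- by rewrite (D1 Y f X Z) (Q1 Y f X Z) scalerDr addrACA.
- by have := Q2 X 1 Y Z; rewrite !scale1r DD => ->; rewrite addrACA.
- have Q0 : Q X 0 = 0.
    have := Q2 X 1 0 0; rewrite !scale1r addr0 => /eqP.
    by rewrite -subr_eq0 opprD addNKr oppr_eq0 => /eqP.
  have := Q2 X f Y 0; rewrite Q0 !addr0 DM => ->.
  by rewrite scalerDr addrA.
Qed.

(** The inhomogeneous Leibniz terms cancel. *)
Lemma derivation_lawB D D' : derivation_law D -> derivation_law D' ->
  tensor12 (fun X Y => D X Y - D' X Y).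
Proof.
move=> [D1 DD DM] [D1' DD' DM']; split=> [Y f X Z|X f Y Z].
- by rewrite (D1 Y f X Z) (D1' Y f X Z) opprD addrACA scalerBr.
- rewrite DD DD' DM DM' opprD addrACA; congr (_ + _).
  by rewrite opprD addrACA subrr add0r scalerBr.
Qed.

Variable phi : {linear XM -> XM}.
Local Notation J := (J_ phi).

Lemma JD X Y : J (X + Y) = J X + J Y.
Proof. by rewrite /J_ linearD mulrnDl opprD addrACA scale_realDr. Qed.

Lemma JZ (f : C) X : J (f *: X) = f *: J X.
Proof. by rewrite /J_ linearZ -scale_realZ scalerBr scalerMnr. Qed.

Lemma JB X Y : J (X - Y) = J X - J Y.
Proof. by rewrite -scaleN1r JD JZ scaleN1r. Qed.

Lemma J_scale_real a X : J (scale_real a X) = scale_real a (J X).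
Proof. exact: JZ. Qed.

(** [(2 phi - 1)^2 = 4 (phi^2 - phi) + 1 = 5]. *)
Lemma JK : almost_golden phi -> involutive J.
Proof.
case=> phi2 _ X.
pose Z := phi X *+ 2 - X.
have phiZ : phi Z *+ 2 - Z = scale_real 5 X.
  have -> : phi Z = phi X + X *+ 2.
    by rewrite linearB linearMn phi2 mulrnDl [phi X *+ 2]mulr2n addrAC addrK.
  rewrite mulrnDl /Z opprB addrC addrA subrK -mulrnA -mulrS.
  by rewrite /scale_real !scaler_nat.
rewrite -[J X]/(scale_real (Num.sqrt 5)^-1 Z) J_scale_real.
rewrite -[J Z]/(scale_real (Num.sqrt 5)^-1 (phi Z *+ 2 - Z)) phiZ.
rewrite !scale_real_comp -invfM -expr2 sqr_sqrtr ?ler0n //.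
by rewrite mulVf ?pnatr_eq0 // scale_real1.
Qed.

Lemma covariant_derivative_J D X Y : derivation_law D ->
  covariant_derivative D J X Y =
  scale_real (2 / Num.sqrt 5) (covariant_derivative D phi X Y).
Proof.
move=> hD; have [_ DD _] := hD.
rewrite mulrC -scale_real_comp scale_real2 /covariant_derivative /J_.
rewrite derivation_law_scale_real // (derivation_law_sub _ _ _ hD) !mulr2n DD.
by rewrite -scale_realBr opprB addrA subrK opprD addrACA.
Qed.

Lemma adapted_J D : derivation_law D ->
  adapted phi D <-> forall X Y, D X (J Y) = J (D X Y).
Proof.
move=> hD; split=> [ad X Y|com X Y].
  apply/eqP; rewrite -subr_eq0; apply/eqP.
  rewrite -[LHS]/(covariant_derivative D J X Y) covariant_derivative_J // ad.
  by rewrite /scale_real scaler0.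
apply: (@scale_real_eq0 (2 / Num.sqrt 5)).
  by rewrite mulf_neq0 ?pnatr_eq0 // invr_eq0 gt_eqF // sqrtr_gt0 ltr0n.
by rewrite -covariant_derivative_J // /covariant_derivative com subrr.
Qed.

Lemma nabla0E nabla X Y : almost_golden phi ->
  nabla0 phi nabla X Y = scale_real 2^-1 (nabla X Y + J (nabla X (J Y))).
Proof.
move=> hphi; rewrite /nabla0 /covariant_derivative JK //.
rewrite -{1}[nabla X Y]scale_real_half -scale_realBr.
by rewrite opprB addrC addrA subrK addrC.
Qed.

(** The inhomogeneous Leibniz term of [J (nabla X (J Y))] is
    [J (X f *: J Y) = X f *: Y], as for [nabla], and the weights [1/2] add up
    to [1]. *)
Lemma nabla0_derivation_law nabla : almost_golden phi ->
  derivation_law nabla -> derivation_law (nabla0 phi nabla).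
Proof.
move=> hphi [D1 DD DM]; split=> [Y f X Z|X Y Z|X f Y]; rewrite !nabla0E //.
- rewrite (D1 Y f X Z) (D1 (J Y) f X Z) JD JZ addrACA -scalerDr.
  by rewrite -scale_realZ -scale_realDr.
- by rewrite JD !DD JD addrACA -scale_realDr.
- rewrite JZ !DM JD 2!JZ JK // addrACA [LHS]scale_realDr.
  by rewrite scale_real_half -scalerDr scale_realZ.
Qed.

Lemma nabla0_J nabla X Y : almost_golden phi ->
  nabla0 phi nabla X (J Y) = J (nabla0 phi nabla X Y).
Proof.
by move=> hphi; rewrite !nabla0E // J_scale_real JD !JK // addrC.
Qed.

End Connections.

Theorem proposition3p2 (R : realType) (n : nat) (M : manifold R n)
    (phi : {linear vector_field M -> vector_field M})
    (nabla : vector_field M -> vector_field M -> vector_field M)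
    (hphi : almost_golden phi) (hnabla : derivation_law nabla) :
  [set D | derivation_law D /\ adapted phi D] =
  [set (fun X Y => nabla0 phi nabla X Y + Q X Y) | Q in tensorL phi].
Proof.
have h0 := nabla0_derivation_law hphi hnabla.
apply/seteqP; split=> [D [hD /(adapted_J phi hD) DJ]|_ [Q [hQ QJ] <-]] /=.
  exists (fun X Y => D X Y - nabla0 phi nabla X Y).
    split=> [|X Y]; first exact: derivation_lawB.
    by rewrite DJ nabla0_J // JB.
  by apply/funext => X; apply/funext => Y; rewrite addrC subrK.
have hD := derivation_lawD h0 hQ.
split=> //; apply/(adapted_J phi hD) => X Y.
by rewrite nabla0_J // QJ JD.
Qed.
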